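(* Let $a\colon \mathbb{N}_0 \to \mathbb{C}$ be a totally balanced automatic sequence. Then, for any ergodic measure-preserving system $(X,\mu,T)$ and any $f \in L^1(\mu)$ we have $$\mathbb{E}_{n<N}\, a(n)\, f(T^n x) \to 0 \quad \text{for } \mu\text{-a.e. } x \in X \text{ as } N \to \infty.$$
   Context: $\mathbb{N}=\{1,2,\dots\}$, $\mathbb{N}_0=\mathbb{N}\cup\{0\}$, and $\mathbb{E}_{n<N}\,x(n)=\frac1N\sum_{n=0}^{N-1}x(n)$. Automatic sequences: for an integer $k\ge 2$ let $\Sigma_k=\{0,\dots,k-1\}$ and let $\Sigma_k^*$ be the set of finite words over $\Sigma_k$ (including the empty word). For $n\in\mathbb{N}_0$, $(n)_k\in\Sigma_k^*$ is the base-$k$ expansion of $n$ without leading zeros, most significant digit on the left ($(0)_k$ is the empty word). A $k$-automaton $(S,s_0,\delta,\tau)$ consists of a finite set of states $S$, an initial state $s_0\in S$, a transition function $\delta\colon S\times\Sigma_k\to S$ and an output function $\tau\colon S\to\Delta$. Extend $\delta$ to $S\times\Sigma_k^*$ by $\delta(s,\text{empty word})=s$ and $\delta(s,uv)=\delta(\delta(s,v),u)$ (so the rightmost digit is read first). A sequence $a\colon\mathbb{N}_0\to\Delta$ is $k$-automatic if $a(n)=\tau(\delta(s_0,(n)_k))$ for some $k$-automaton, and automatic if it is $k$-automatic for some $k\ge2$. A bounded sequence $a\colon\mathbb{N}_0\to\mathbb{C}$ is totally balanced if $\mathbb{E}_{n<N}\,a(qn+r)\to0$ as $N\to\infty$ for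 every $q\in\mathbb{N}$, $r\in\mathbb{N}_0$ (equivalently, $\mathbb{E}_{n<N}\,a(n)b(n)\to 0$ for every periodic $b$). A measure-preserving system $(X,\mu,T)$ is a probability space $(X,\mu)$ with a $\mu$-preserving map $T\colon X\to X$. *)

(* Defs.v *)
From HB Require Import structures.
From mathcomp Require Import all_boot all_order all_algebra.
From mathcomp Require Import complex.
From mathcomp Require Import all_classical all_reals all_analysis.

Set Implicit Arguments.
Unset Strict Implicit.
Unset Printing Implicit Defensive.

Import Order.TTheory GRing.Theory Num.Theory.
Import numFieldNormedType.Exports.

Local Open Scope classical_set_scope.
Local Open Scope ring_scope.
Local Open Scope complex_scope.

(* The usual topology of the complex numbers: R[i] is a numFieldType, and as
   such carries the topology given by its norm `|z|. *)
HB.instance Definition _ (R : realType) :=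
  PseudoMetricNormedZmod.copy R[i] (R[i] : numFieldType).

Section BaseExpansion.
Local Open Scope nat_scope.
Variables (k : nat) (k_gt1 : 1 < k).

Definition last_digit (n : nat) : 'I_k :=
  Ordinal (ltn_pmod n (ltnW k_gt1)).

Fixpoint expansion_rec (fuel n : nat) : seq 'I_k :=
  if fuel is fuel'.+1 then
    if n == 0 then [::]
    else rcons (expansion_rec fuel' (n %/ k)) (last_digit n)
  else [::].

(* The base-k expansion of n, most significant digit first and without leading
   zeros. The fuel n suffices because n %/ k < n; see expansion0 and
   expansionE. *)
Definition expansion (n : nat) : seq 'I_k := expansion_rec n n.

Lemma expansion_rec_fuel (fuel n : nat) :
  n <= fuel -> expansion_rec fuel n = expansion n.
Proof.
elim/ltn_ind: n fuel => -[|n] IHn [|fuel] //= le_n.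
have lt_div : n.+1 %/ k < n.+1 by exact: ltn_Pdiv.
by rewrite /expansion /= !IHn // -ltnS ?(leq_trans lt_div).
Qed.

Lemma expansion0 : expansion 0 = [::].
Proof. by []. Qed.

Lemma expansionE (n : nat) : 0 < n ->
  expansion n = rcons (expansion (n %/ k)) (last_digit n).
Proof.
case: n => // n _; rewrite {1}/expansion /= expansion_rec_fuel //.
by rewrite -ltnS ltn_Pdiv.
Qed.

End BaseExpansion.

Record automaton (k : nat) (D : Type) := Automaton {
  state : finType;
  init : state;
  trans : state -> 'I_k -> state;
  out : state -> D
}.

(* The transition function extended to words: foldr consumes the rightmost
   (least significant) digit first. *)
Definition trans_word (k : nat) (D : Type) (A : automaton k D)
    (s : state A) (w : seq 'I_k) : state A :=
  foldr (fun d s' => trans s' d) s w.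

Definition k_automatic (k : nat) (D : Type) (a : nat -> D) : Prop :=
  exists (k_gt1 : (1 < k)%N) (A : automaton k D),
    forall n, a n = out (trans_word (init A) (expansion k_gt1 n)).

Definition automatic (D : Type) (a : nat -> D) : Prop :=
  exists k, k_automatic k a.

Definition average (R : realType) (x : nat -> R[i]) (N : nat) : R[i] :=
  N%:R^-1 * \sum_(n < N) x n.

Definition totally_balanced (R : realType) (a : nat -> R[i]) : Prop :=
  bounded_fun a /\
  forall q r : nat, (0 < q)%N ->
    average (fun n => a (q * n + r)%N) @ \oo --> (0 : R[i]).

Definition measure_preserving (d : measure_display) (X : measurableType d)
    (R : realType) (mu : probability X R) (T : X -> X) : Prop :=
  measurable_fun setT T /\
  forall A : set X, measurable A -> mu (T @^-1` A) = mu A.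

Definition ergodic (d : measure_display) (X : measurableType d)
    (R : realType) (mu : probability X R) (T : X -> X) : Prop :=
  measure_preserving mu T /\
  forall A : set X, measurable A -> T @^-1` A = A ->
    mu A = 0%E \/ mu A = 1%E.

(* Membership in L^1(mu) of a complex-valued function; integrability of a
   real-valued function includes its measurability. *)
Definition complex_integrable (d : measure_display) (X : measurableType d)
    (R : realType) (mu : probability X R) (f : X -> R[i]) : Prop :=
  mu.-integrable setT (fun x => (complex.Re (f x))%:E) /\
  mu.-integrable setT (fun x => (complex.Im (f x))%:E).

(* Main.v *)
Require Import Defs.
From mathcomp Require Import all_boot all_order all_algebra.
From mathcomp Require Import complex.
From mathcomp Require Import all_classical all_reals all_analysis.
From mathcomp Require Import measurable_realfun.
From mathcomp Require Import ring lra.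
Import Order.TTheory GRing.Theory Num.Theory.
Import numFieldNormedType.Exports.

(** The sequence is self-similar. If [M] is a power of the base [k] and [m > 0],
    the value [a (m * M ^ j + n)] for [n < M ^ j] depends only on the state in
    which the low digits [n] leave the automaton and on the map that the leading
    digits [m] induce on states; there are only finitely many such maps. Hence an
    operator-valued sum [\sum_(n < M ^ j) a (m * M ^ j + n) U ^ n] is a [j]-fold
    product of sums over one block of length [M], and a gain over the trivial
    bound for one block gives an exponential gain.

    The gain comes from rigidity, and no spectral theory is involved. If a sum
    [\sum_(n < M) U ^ n h_(s_n)], where [U] is an isometry of a Hilbert space and
    [s_n] the state after the digits of [n], has almost the trivial size, uniform
    convexity makes all its terms almost equal to a single vector. By the
    pigeonhole principle two small indices share a state, so this vector is almost
    periodic under [U], and the vectors [h_(s_n)] are almost constant along the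
    multiples of a bounded number [q]. But they are combinations of values
    of [a] along progressions, and total balance makes their average along these multiples small
    ([block_contraction]). This proves the power saving of
    [automatic_block_decay], uniformly for all isometries; one may think of it as
    a bound on exponential sums that is uniform in the frequency.

    For a bounded function [f] on a measure-preserving system, the power saving in
    L^2 is summable over [j], so almost everywhere the means of [a n * f (T^n x)]
    over the intervals from [m * M ^ j] to [m.+1 * M ^ j] tend to 0 for every
    [m > 0]; a long interval [0, N) consists of boundedly many of these and of a
    small proportion that is negligible as [f] is bounded
    ([bounded_weighted_ergodic]). The maximal ergodic inequality extends the
    convergence to integrable [f] ([integrable_weighted_ergodic]), and the complex
    case follows by taking real and imaginary parts of [a] and of [f]. *)

Set Implicit Arguments.
Unset Strict Implicit.
Unset Printing Implicit Defensive.

Local Open Scope classical_set_scope.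
Local Open Scope ring_scope.
Local Open Scope complex_scope.

(** * Reading base-k digits *)

Section Digits.
Local Open Scope nat_scope.
Variables (k : nat) (k_gt1 : 1 < k).

(** The state reached after exactly [L] digits, padded by leading zeros when [n]
    is short. All these words have the same length, so that blocks of digits can
    be concatenated, which the expansions without leading zeros do not allow. *)
Fixpoint run (S : Type) (delta : S -> 'I_k -> S) (L : nat) (s : S) (n : nat) :
    S :=
  if L is L'.+1 then run delta L' (delta s (last_digit k_gt1 n)) (n %/ k)
  else s.

Lemma runD (S : Type) (delta : S -> 'I_k -> S) (L L' : nat) (s : S) (n : nat) :
  run delta (L + L') s n = run delta L' (run delta L s n) (n %/ k ^ L).
Proof.
elim: L s n => [|L IH] s n /=; first by rewrite divn1.
by rewrite IH -divnMA expnS.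
Qed.

Lemma run_modn (S : Type) (delta : S -> 'I_k -> S) (L : nat) (s : S)
    (n j : nat) :
  run delta L s (j * k ^ L + n) = run delta L s n.
Proof.
elim: L s n j => [|L IH] s n j //=.
have -> : last_digit k_gt1 (j * k ^ L.+1 + n) = last_digit k_gt1 n.
  by apply: val_inj; rewrite /= expnS mulnCA [k * _]mulnC modnMDl.
by rewrite expnS mulnCA [k * _]mulnC divnMDl ?(ltnW k_gt1) // IH.
Qed.

Lemma trans_word_run (D : Type) (A : automaton k D) (L : nat) (s : state A)
    (n : nat) :
  0 < n %/ k ^ L ->
  trans_word s (expansion k_gt1 n) =
    trans_word (run (trans (a:=A)) L s n) (expansion k_gt1 (n %/ k ^ L)).
Proof.
elim: L s n => [|L IH] s n /=; first by rewrite divn1.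
rewrite expnS divnMA => gt0.
have n_gt0 : 0 < n.
  by case: n gt0 => //; rewrite div0n div0n.
rewrite -IH // [in LHS]expansionE // /trans_word foldr_rcons //.
Qed.

(** The bound [i < k ^ l] makes [i] the low digits of [m * k ^ l + i] for every
    [m], so that whatever happens from a reached state is visible in the
    sequence itself, along the progression [i] modulo [k ^ l]. *)
Definition reached (D : Type) (A : automaton k D) (s : state A) : Prop :=
  exists l i, i < k ^ l /\ s = run (trans (a:=A)) l (init A) i.

Lemma reached_init (D : Type) (A : automaton k D) : reached (init A).
Proof. by exists 0, 0. Qed.

Lemma reached_trans (D : Type) (A : automaton k D) (s : state A) (d : 'I_k) :
  reached s -> reached (trans s d).
Proof.
move=> [l [i [lt_i ->]]]; exists (l + 1), (d * k ^ l + i); split.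
  rewrite addn1 expnS.
  have : (d * k ^ l + i < d.+1 * k ^ l) by rewrite mulSn addnC ltn_add2r.
  by move=> /leq_trans; apply; rewrite leq_mul2r ltn_ord orbT.
rewrite runD run_modn divnMDl ?expn_gt0 ?(ltnW k_gt1) // divn_small // addn0 /=.
by congr (trans _ _); apply: val_inj; rewrite /= modn_small.
Qed.

(** Total balance of the sequence says nothing about the states that the
    automaton cannot reach, so they are removed. *)
Section Trim.
Variables (D : Type) (A : automaton k D).

Let S' := {s : state A | `[< reached s >]}.

Let init' : S' := exist _ (init A) (asboolT (reached_init A)).

Let trans' (s : S') (d : 'I_k) : S' :=
  exist _ (trans (val s) d) (asboolT (reached_trans d (asboolW (valP s)))).

Definition trim : automaton k D := Automaton init' trans' (fun s => out (val s)).

Lemma val_trans_word_trim (s : state trim) (w : seq 'I_k) :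
  val (trans_word s w) = trans_word (val s) w.
Proof. by elim: w => //= d w ->. Qed.

Lemma val_run_trim (L : nat) (s : state trim) (n : nat) :
  val (run (trans (a:=trim)) L s n) = run (trans (a:=A)) L (val s) n.
Proof. by elim: L s n => //= L IH s n; rewrite IH. Qed.

Lemma trim_out (n : nat) :
  out (trans_word (init trim) (expansion k_gt1 n)) =
  out (trans_word (init A) (expansion k_gt1 n)).
Proof. by rewrite -(val_trans_word_trim (init trim)). Qed.

Lemma trim_reached (s : state trim) : reached s.
Proof.
have [l [i [lt_i s_eq]]] := asboolW (valP s).
exists l, i; split => //; apply: val_inj.
by rewrite val_run_trim -s_eq.
Qed.

End Trim.
End Digits.

(** * Shift-invariant Euclidean seminorms *)

Section Seminorm.
Variable R : realFieldType.

(** Stands for [N p = || p(U) f ||], where [U] is the isometry [g |-> g \o T] of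
    L^2 and [f] is fixed. All the vectors occurring in the argument lie in the
    cyclic module of [f]; with polynomials as formal vectors the functional
    analysis reduces to these five properties. *)
Record shift_seminorm (N : {poly R} -> R) : Prop := ShiftSeminorm {
  sn_ge0 : forall p, 0 <= N p;
  sn_triangle : forall p q, N (p + q) <= N p + N q;
  sn_scale : forall c p, N (c *: p) = `|c| * N p;
  sn_parallelogram : forall p q,
    N (p + q) ^+ 2 + N (p - q) ^+ 2 = 2 * (N p ^+ 2 + N q ^+ 2);
  sn_shift : forall p, N ('X * p) = N p
}.

Variables (N : {poly R} -> R) (hN : shift_seminorm N).

Lemma sn_0 : N 0 = 0.
Proof. by rewrite -(scale0r 0) sn_scale // normr0 mul0r. Qed.

Lemma sn_dist_triangle q p r : N (p - r) <= N (p - q) + N (q - r).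
Proof. by rewrite -(subrKA q) sn_triangle. Qed.

Lemma sn_shiftX n p : N ('X^n * p) = N p.
Proof.
by elim: n => [|n IH]; rewrite ?expr0 ?mul1r // exprS -mulrA sn_shift.
Qed.

Lemma sn_sum (J : Type) (r : seq J) (P : pred J) (F : J -> {poly R}) :
  N (\sum_(j <- r | P j) F j) <= \sum_(j <- r | P j) N (F j).
Proof.
elim/big_ind2: _ => [|x1 x2 y1 y2 h1 h2|//]; first by rewrite sn_0.
exact: le_trans (sn_triangle hN _ _) (lerD h1 h2).
Qed.

(** If [M] vectors of norm at most [K] have a sum of norm almost [M * K], they
    are almost equal: by the triangle inequality [x n + x m] already has norm
    almost [2 * K], and the parallelogram identity then bounds [x n - x m]. *)
Lemma sn_uniform_convexity (M : nat) (x : 'I_M -> {poly R}) (K eta : R) :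
    0 <= K -> 0 <= eta -> eta * M%:R <= 1 ->
    (forall n, N (x n) <= K) ->
    (1 - eta) * M%:R * K < N (\sum_n x n) ->
  forall n m, N (x n - x m) ^+ 2 <= 4 * eta * M%:R * K ^+ 2.
Proof.
move=> K_ge0 eta_ge0 eta_small xK big n m.
have M_ge0 : 0 <= M%:R :> R by rewrite ler0n.
have [->|neq] := eqVneq n m.
  by rewrite subrr sn_0 expr0n /= !mulr_ge0 // exprn_ge0.
have sumK : N (\sum_n x n) <= N (x n + x m) + (M%:R - 2) * K.
  rewrite (bigD1 n) //= (bigD1 m) 1?eq_sym //= addrA.
  apply: le_trans (sn_triangle hN _ _) _; rewrite lerD2l.
  apply: le_trans (sn_sum _ _ _) _.
  apply: le_trans (ler_sum _ (fun i _ => xK i)) _.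
  rewrite sumr_const -[K *+ _]mulr_natl ler_wpM2r //.
  have card_rest : (M = 2 + #|[pred i | (i != n) && (i != m)]|)%N.
    rewrite -[LHS](card_ord M) -(cardC (pred2 n m)) card2 neq; congr (_ + _)%N.
    by apply: eq_card => i; rewrite !inE negb_or.
  by rewrite [in leRHS]card_rest natrD addrAC subrr add0r.
have lb : (2 - eta * M%:R) * K <= N (x n + x m) by nra.
have par := sn_parallelogram hN (x n) (x m).
have sqn : N (x n) ^+ 2 <= K ^+ 2 by rewrite lerXn2r ?nnegrE ?(sn_ge0 hN) ?xK.
have sqm : N (x m) ^+ 2 <= K ^+ 2 by rewrite lerXn2r ?nnegrE ?(sn_ge0 hN) ?xK.
have lbK : 0 <= (2 - eta * M%:R) * K by apply: mulr_ge0 => //; lra.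
have sqlb : ((2 - eta * M%:R) * K) ^+ 2 <= N (x n + x m) ^+ 2.
  by rewrite lerXn2r ?nnegrE ?(sn_ge0 hN) ?xK.
have : 0 <= (eta * M%:R * K) ^+ 2 by exact: sqr_ge0.
move: par sqn sqm sqlb.
rewrite !expr2; nra.
Qed.

End Seminorm.

Section Span.
Variables (R : realFieldType) (S I : finType) (b : I -> S -> R).

(** The matrix identity [B *m pinvmx B *m B = B], for the matrix with entries
    [b i s]. *)
Lemma generalized_inverse : exists c : S -> I -> R,
  forall i s, \sum_j (\sum_t b i t * c t j) * b j s = b i s.
Proof.
pose B : 'M[R]_(#|I|, #|S|) := \matrix_(i, t) b (enum_val i) (enum_val t).
exists (fun t j => pinvmx B (enum_rank t) (enum_rank j)) => i s.
have := congr1 (fun A : 'M[R]_(#|I|, #|S|) => A (enum_rank i) (enum_rank s))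
  (mulmxKpV (submx_refl B)).
rewrite !mxE !enum_rankK => <-.
rewrite [RHS](reindex (@enum_rank I)) /=; last exact/onW_bij/enum_rank_bij.
apply: eq_bigr => j _; rewrite !mxE !enum_rankK; congr (_ * _).
rewrite [RHS](reindex (@enum_rank S)) /=; last exact/onW_bij/enum_rank_bij.
by apply: eq_bigr => t _; rewrite !mxE !enum_rankK.
Qed.

(** The coefficients of a combination [h] of the [b i] can be chosen of the size
    of [h]: the row [h *m pinvmx B] is one choice, and it depends linearly on the
    values of [h], by a matrix that has nothing to do with [N]. *)
Lemma bounded_coefficients : exists C : R, 0 <= C /\
  forall (N : {poly R} -> R), shift_seminorm N ->
  forall (f : I -> {poly R}) (K : R), 0 <= K ->
    (forall s, N (\sum_i b i s *: f i) <= K) ->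
  exists2 g : I -> {poly R}, forall i, N (g i) <= C * K &
    forall s, \sum_i b i s *: g i = \sum_i b i s *: f i.
Proof.
have [c cP] := generalized_inverse.
exists (\sum_j \sum_t `|c t j|); split.
  by apply: sumr_ge0 => j _; apply: sumr_ge0.
move=> N hN f K K_ge0 hK.
exists (fun j => \sum_t c t j *: \sum_i b i t *: f i) => [j|s].
  apply: le_trans (sn_sum hN _ _ _) _.
  apply: (@le_trans _ _ ((\sum_t `|c t j|) * K)).
    rewrite mulr_suml; apply: ler_sum => t _.
    by rewrite sn_scale // ler_wpM2l.
  rewrite ler_wpM2r // (bigD1 j) //= lerDl.
  by apply: sumr_ge0 => i _; apply: sumr_ge0.
under eq_bigr => j _ do rewrite scaler_sumr.
under eq_bigr => j _ do under eq_bigr => t _ do rewrite scalerA scaler_sumr.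
under eq_bigr => j _ do rewrite exchange_big.
rewrite exchange_big; apply: eq_bigr => i _ /=.
rewrite -[in RHS](cP i s) scaler_suml; apply: eq_bigr => j _.
rewrite mulr_suml scaler_suml; apply: eq_bigr => t _.
by rewrite scalerA; congr (_ *: _); ring.
Qed.

End Span.

(** * One block contracts *)

Section Contraction.
Variables (R : realFieldType) (k : nat) (k_gt1 : (1 < k)%N).
Variables (S I : finType) (delta : S -> 'I_k -> S) (b : I -> S -> R).

Local Notation run := (run k_gt1 delta).

(** The form in which total balance enters the contraction. The step [q] is
    bounded because it comes from the pigeonhole principle on states; this is
    what lets one [L0] serve all [q], [i] and [s]. *)
Definition balanced_along_progressions : Prop :=
  forall eps : R, 0 < eps -> exists L0 : nat, forall L, (L0 <= L)%N ->
  forall q, (0 < q <= #|S|)%N -> forall i s,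
    `|\sum_(j < k ^ L %/ q) b i (run L s (q * j))| <= eps * (k ^ L %/ q)%:R.

Hypothesis b_balanced : balanced_along_progressions.

Lemma repeated_state (L : nat) (s : S) : exists i j : nat,
  [/\ (i < j)%N, (j <= #|S|)%N & run L s i = run L s j].
Proof.
pose p (j : 'I_#|S|.+1) := run L s j.
have /injectivePn[x [y xy pxy]] : ~~ injectiveb p.
  by apply/injectiveP => /leq_card; rewrite card_ord ltnn.
wlog lt_xy : x y xy pxy / (x < y)%N => [hwlog|].
  have /orP[] : ((x < y) || (y < x))%N by rewrite -neq_ltn.
    by apply: hwlog pxy.
  by apply: hwlog (esym pxy); rewrite 1?eq_sym.
by exists x, y; split => //; rewrite -ltnS.
Qed.

(** A gain over the trivial bound [k ^ L * K]. Suppose there is none. By uniform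
    convexity all the terms of the sum are close to its first one, [x0]. Among
    the first [#|S|.+1] terms two have the same state, at distance [q], so
    multiplication by ['X^(d * q)] almost fixes [x0]. Dividing the term of index
    [q * m] by ['X^(d * (q * m))] then shows that the vector attached to the
    state [run L s (q * m)] is close to [x0] for every [m]. But these vectors
    are combinations of the [b i] with bounded coefficients, hence their average
    over [m] is small by balance: a contradiction. The gain depends neither on
    [N] nor on [d]. *)
Lemma block_contraction : exists (L : nat) (eta : R),
  [/\ (0 < L)%N, 0 < eta, eta <= 1 &
  forall N, shift_seminorm N -> forall (d : nat) (f : I -> {poly R}) (K : R),
    0 <= K -> (forall s, N (\sum_i b i s *: f i) <= K) ->
  forall s, N (\sum_(n < k ^ L)
      'X^(d * n) * \sum_i b i (run L s n) *: f i) <= (1 - eta) * (k ^ L)%:R * K].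
Proof.
have [C [C_ge0 coefP]] := bounded_coefficients b.
pose CI : R := #|I|%:R * C.
have CI_ge0 : 0 <= CI by rewrite mulr_ge0.
pose eps0 : R := (4 * (CI + 1))^-1.
have eps0_gt0 : 0 < eps0 by rewrite invr_gt0; lra.
have [L0 L0P] := b_balanced eps0_gt0.
have [L [L_gt0 L0_le S_le]] : exists L, [/\ 0 < L, L0 <= L & #|S| <= L]%N.
  by exists (maxn L0 #|S|).+1; split=> //; apply: leqW; rewrite ?leq_maxl ?leq_maxr.
pose M := (k ^ L)%N.
have S_lt_M : (#|S| < M)%N.
  exact: leq_ltn_trans (ltn_expl L k_gt1).
have M_gt0 : (0 < M)%N by exact: leq_ltn_trans S_lt_M.
have M_ge1 : 1 <= M%:R :> R by rewrite ler1n.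
(* Chosen so that the errors accumulated along a progression of at most M terms
   stay below 2 * eps * M * K = K / 8. *)
pose eps : R := (16 * M%:R)^-1.
have epsM : eps * M%:R = 1 / 16.
  by rewrite /eps invfM -mulrA mulVf ?mulr1 ?div1r //; lra.
have eps_gt0 : 0 < eps by rewrite invr_gt0; lra.
have eps_le : eps <= 1 / 16 by nra.
(* Uniform convexity turns a defect eta into distances at most
   sqrt (4 * eta * M) * K = eps * K. *)
pose eta : R := eps ^+ 2 / (4 * M%:R).
have etaM : 4 * eta * M%:R = eps ^+ 2 by rewrite /eta; field; lra.
have eta_gt0 : 0 < eta by rewrite divr_gt0 ?exprn_gt0 //; lra.
have eta_le : eta <= 1 / 16.
  have : eps ^+ 2 <= 1 / 16 by rewrite expr2; nra.
  by nra.
exists L, eta; split; [by []|by []|by lra|].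
move=> N hN d f K K_ge0 hK s; rewrite leNgt; apply/negP => big.
set h := (fun s => \sum_i b i s *: f i) in hK big.
rewrite -/M in big.
pose x (n : 'I_M) := 'X^(d * n) * h (run L s n).
have xK n : N (x n) <= K by rewrite /x (sn_shiftX hN) hK.
have K_gt0 : 0 < K.
  rewrite lt_neqAle K_ge0 andbT; apply/eqP => K0.
  move: big; rewrite -K0 mulr0 ltNge => /negP; apply.
  apply: le_trans (sn_sum hN _ _ _) _.
  by apply: sumr_le0 => n _; rewrite (le_trans (xK n)) // -K0.
have close n m : N (x n - x m) <= eps * K.
  rewrite -(@ler_pXn2r _ 2) ?nnegrE ?(sn_ge0 hN) //; last by rewrite mulr_ge0 // ltW.
  have : eta * M%:R <= 1.
    by have := etaM; rewrite expr2; nra.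
  move/(sn_uniform_convexity hN K_ge0 (ltW eta_gt0)) => /(_ _ xK big n m).
  by rewrite etaM exprMn.
pose n0 : 'I_M := Ordinal M_gt0.
pose x0 := x n0.
have x0_big : (1 - eta - eps) * K < N x0.
  have sum_le : N (\sum_n x n) <= M%:R * (N x0 + eps * K).
    apply: le_trans (sn_sum hN _ _ _) _.
    rewrite mulr_natl -[M in leRHS]card_ord -sumr_const.
    apply: ler_sum => n _.
    rewrite -[x n](subrK x0) addrC.
    by apply: le_trans (sn_triangle hN _ _) _; rewrite lerD2l close.
  have := lt_le_trans big sum_le.
  have -> : (1 - eta) * M%:R * K = M%:R * ((1 - eta) * K) by ring.
  rewrite ltr_pM2l; last lra.
  lra.
have [i [j [lt_ij j_le same]]] := repeated_state L s.
have j_lt : (j < M)%N := leq_ltn_trans j_le S_lt_M.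
have i_lt : (i < M)%N := ltn_trans lt_ij j_lt.
pose q := (j - i)%N.
have q_gt0 : (0 < q)%N by rewrite subn_gt0.
have q_le : (q <= #|S|)%N by exact: leq_trans (leq_subr _ _) j_le.
have period : N ('X^(d * q) * x0 - x0) <= 2 * eps * K.
  have xij : 'X^(d * q) * x (Ordinal i_lt) = x (Ordinal j_lt).
    rewrite /x /= -same mulrA -exprD -mulnDr subnK //.
    exact: ltnW.
  apply: le_trans (sn_dist_triangle hN (x (Ordinal j_lt)) _ _) _.
  rewrite -xij -mulrBr (sn_shiftX hN) xij.
  have := close n0 (Ordinal i_lt); have := close (Ordinal j_lt) n0.
  rewrite -/x0; lra.
have periods m : N ('X^(d * (q * m)) * x0 - x0) <= m%:R * (2 * eps * K).
  elim: m => [|m IH]; first by rewrite !muln0 expr0 mul1r subrr (sn_0 hN) mul0r.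
  rewrite mulnS mulnDr exprD -mulrA.
  apply: le_trans (sn_dist_triangle hN ('X^(d * q) * x0) _ _) _.
  rewrite -mulrBr (sn_shiftX hN) mulrS mulrDl mul1r [leRHS]addrC.
  exact: lerD.
pose J := (M %/ q)%N.
have J_gt0 : (0 < J)%N by rewrite divn_gt0 // (leq_trans q_le) // ltnW.
have near_x0 (m : 'I_J) : N (x0 - h (run L s (q * m))) <= K / 8.
  have qm_lt : (q * m < M)%N.
    apply: leq_trans (leq_trunc_div M q).
    by rewrite mulnC ltn_mul2r q_gt0 ltn_ord.
  rewrite -(sn_shiftX hN (d * (q * m))) mulrBr.
  apply: le_trans (sn_dist_triangle hN x0 _ _) _.
  have := close n0 (Ordinal qm_lt).
  rewrite -/x0 /x /= => cl.
  have m_lt : m%:R + 1 <= M%:R :> R.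
    rewrite natr1 ler_nat.
    exact: leq_trans (ltn_ord m) (leq_div _ _).
  have := periods m.
  have : (m%:R + 1) * (2 * eps * K) <= M%:R * (2 * eps * K).
    by rewrite ler_wpM2r // !mulr_ge0 // ltW.
  have -> : M%:R * (2 * eps * K) = (eps * M%:R) * 2 * K by ring.
  rewrite epsM mulrDl mul1r.
  have : 0 <= eps * K by rewrite mulr_ge0 // ltW.
  by lra.
have upper : J%:R * N x0 <= N (\sum_(m < J) h (run L s (q * m))) + J%:R * (K / 8).
  have -> : J%:R * N x0 = N (\sum_(m < J) x0).
    by rewrite sumr_const card_ord -[x0 *+ J]scaler_nat (sn_scale hN) // ger0_norm.
  rewrite -[X in N X <= _](subrK (\sum_(m < J) h (run L s (q * m)))) addrC.
  apply: le_trans (sn_triangle hN _ _) _; rewrite lerD2l -sumrB.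
  apply: le_trans (sn_sum hN _ _ _) _.
  apply: le_trans (ler_sum _ (fun m _ => near_x0 m)) _.
  by rewrite sumr_const card_ord mulr_natl.
have [g g_le g_eq] := coefP N hN f K K_ge0 hK.
have small : N (\sum_(m < J) h (run L s (q * m))) <= J%:R * (K / 4).
  under eq_bigr => m _ do rewrite /h -g_eq.
  rewrite exchange_big /=.
  under eq_bigr => t _ do rewrite -scaler_suml.
  apply: le_trans (sn_sum hN _ _ _) _.
  apply: (@le_trans _ _ (\sum_(t : I) (eps0 * J%:R) * (C * K))).
    apply: ler_sum => t _; rewrite (sn_scale hN) //; apply: ler_pM => //.
    - exact: sn_ge0.
    - by apply: L0P; rewrite ?q_gt0.
  rewrite sumr_const -[leLHS]mulr_natl.
  have -> : #|I|%:R * (eps0 * J%:R * (C * K)) = J%:R * (CI * eps0 * K).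
    by rewrite /CI; ring.
  rewrite ler_wpM2l // mulrC ler_wpM2l //.
  rewrite /eps0 ler_pdivrMr; lra.
have : J%:R * N x0 <= J%:R * (K * 3 / 8) by lra.
rewrite ler_pM2l ?ltr0n //.
have : (eta + eps) * K <= 1 / 8 * K by rewrite ler_wpM2r //; lra.
by lra.
Qed.

End Contraction.

(** * Iterating the contraction *)

Lemma sum_nat_mul (V : zmodType) (F : nat -> V) (a b : nat) :
  \sum_(n < a * b) F n = \sum_(i < a) \sum_(j < b) F (i * b + j)%N.
Proof.
rewrite -(big_mkord xpredT F) big_nat_mul big_mkord; apply: eq_bigr => i _.
rewrite -[X in index_iota X _](add0n (i * b)%N) big_addn mulSn addnK big_mkord.
by apply: eq_bigr => j _; rewrite addnC.
Qed.

Section Decay.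
Variables (R : realFieldType) (k : nat) (k_gt1 : (1 < k)%N).
Variables (S I : finType) (delta : S -> 'I_k -> S) (b : I -> S -> R).

Local Notation run := (run k_gt1 delta).

Hypothesis b_balanced : balanced_along_progressions k_gt1 delta b.
Hypothesis b_closed : forall i d, exists i', forall s, b i (delta s d) = b i' s.

Lemma closed_run (L n : nat) (i : I) :
  exists i', forall s, b i (run L s n) = b i' s.
Proof.
elim: L n => [|L IH] n; first by exists i.
have [i1 i1P] := IH (n %/ k)%N.
have [i2 i2P] := b_closed i1 (last_digit k_gt1 n).
by exists i2 => s /=; rewrite i1P i2P.
Qed.

(** Splitting off the [L] lowest digits writes a sum over [(k ^ L) ^ j.+1] as a
    sum over one block, whose coefficients are sums of the same kind over
    [(k ^ L) ^ j] with [d] replaced by [d * k ^ L]. By [b_closed] these lie in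
    the span of the [b i], so that the contraction applies at every step. *)
Lemma block_decay : exists (L : nat) (rho C : R),
  [/\ (0 < L)%N, 0 <= rho < 1, 0 <= C &
  forall N, shift_seminorm N -> forall (i : I) (j d : nat) (s : S),
    N (\sum_(n < (k ^ L) ^ j) b i (run (L * j) s n) *: 'X^(d * n)) <=
      C * (rho * (k ^ L)%:R) ^+ j * N 1].
Proof.
have [L [eta [L_gt0 eta_gt0 eta_le1 contract]]] := block_contraction b_balanced.
exists L, (1 - eta), (\sum_i \sum_s `|b i s|); split => //; first lra.
  by do 2![apply: sumr_ge0 => ? _].
set C := \sum_i _; set M := (k ^ L)%N => N hN i.
have C_ge0 : 0 <= C by do 2![apply: sumr_ge0 => ? _].
elim=> [|j IH] d s.
  rewrite expn0 big_ord1 !muln0 /= !expr0 mulr1 (sn_scale hN).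
  apply: ler_wpM2r; first exact: (sn_ge0 hN).
  rewrite /C (bigD1 i) //= (bigD1 s) //= -addrA lerDl addr_ge0 ?sumr_ge0 //.
  by move=> ? _; apply: sumr_ge0.
pose H d' t := \sum_(n < M ^ j) b i (run (L * j) t n) *: 'X^(d' * n) : {poly R}.
have -> : \sum_(n < M ^ j.+1) b i (run (L * j.+1) s n) *: 'X^(d * n) =
    \sum_(n < M) 'X^(d * n) * H (d * M)%N (run L s n).
  rewrite expnSr.
  rewrite (sum_nat_mul (fun n => b i (run (L * j.+1) s n) *: 'X^(d * n))).
  rewrite exchange_big /=; apply: eq_bigr => n0 _.
  rewrite mulr_sumr; apply: eq_bigr => n1 _.
  rewrite mulnS runD run_modn divnMDl ?expn_gt0 ?(ltnW k_gt1) // divn_small // addn0.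
  rewrite -scalerAr -exprD; congr (_ *: 'X^ _).
  by rewrite mulnDr addnC -mulnA [(M * n1)%N]mulnC.
have [sigma sigmaP] : {sigma : nat -> I |
    forall n t, b i (run (L * j) t n) = b (sigma n) t}.
  exists (fun n => projT1 (cid (closed_run (L * j) n i))) => n t.
  by case: (cid _).
pose f d' i' : {poly R} := \sum_(n < M ^ j | sigma n == i') 'X^(d' * n).
have Hf d' t : H d' t = \sum_i' b i' t *: f d' i'.
  rewrite /H (partition_big (fun n : 'I_(M ^ j) => sigma n) xpredT) //=.
  apply: eq_bigr => i' _; rewrite /f scaler_sumr; apply: eq_bigr => n /eqP <-.
  by rewrite sigmaP.
pose K := C * ((1 - eta) * M%:R) ^+ j * N 1.
have K_ge0 : 0 <= K.
  rewrite mulr_ge0 ?(sn_ge0 hN) // mulr_ge0 // exprn_ge0 // mulr_ge0 //; lra.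
have -> : C * ((1 - eta) * M%:R) ^+ j.+1 * N 1 = (1 - eta) * M%:R * K.
  by rewrite /K exprS; ring.
under eq_bigr => n _ do rewrite Hf.
by apply: contract => // t; rewrite -Hf; apply: IH.
Qed.

End Decay.

(** * Total balance along arithmetic progressions *)

Section Balance.
Variable R : realType.

Definition balanced (a : nat -> R) : Prop := forall q r : nat, (0 < q)%N ->
  (fun N : nat => N%:R^-1 * \sum_(n < N) a (q * n + r)%N) @ \oo --> (0 : R).

Lemma eventually_all (T : finType) (P : T -> nat -> Prop) :
  (forall t, exists L0, forall L, (L0 <= L)%N -> P t L) ->
  exists L0, forall L, (L0 <= L)%N -> forall t, P t L.
Proof.
move=> /choice[L0 L0P]; exists (\max_t L0 t) => L le_L t.
by apply: L0P; apply: leq_trans le_L; exact: leq_bigmax.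
Qed.

(** Balance, made uniform in the offset [r]: as [r] and its remainder modulo [q]
    give the same progression up to a shift by [r %/ q], a sum from offset [r] is
    a difference of two sums from the remainder. *)
Lemma balanced_sum_le (a : nat -> R) (q : nat) (eps : R) :
    balanced a -> (0 < q)%N -> 0 < eps ->
  exists2 C : R, 0 <= C & forall r N : nat,
    `|\sum_(n < N) a (q * n + r)%N| <= eps * (N%:R + 2 * (r %/ q)%:R) + C.
Proof.
move=> a_bal q_gt0 eps_gt0.
have /choice[C CP] : forall r, exists C : R, 0 <= C /\
    forall N, `|\sum_(n < N) a (q * n + r)%N| <= eps * N%:R + C.
  move=> r.
  have /cvgr0Pnorm_le /(_ eps eps_gt0) [N0 _ N0P] := a_bal q r q_gt0.
  exists (\sum_(n < N0) `|a (q * n + r)%N|); split; first exact: sumr_ge0.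
  move=> N; have [le_N|lt_N] := leqP N0 N.
    have := N0P N le_N; rewrite /= normrM normfV [ `|_%:R|]ger0_norm //.
    have [->|N_gt0] := posnP N.
      by rewrite big_ord0 normr0 addr_ge0 ?mulr_ge0 ?sumr_ge0 // ltW.
    rewrite mulrC ler_pdivrMr ?ltr0n // => /le_trans; apply.
    by rewrite lerDl sumr_ge0.
  apply: le_trans (ler_norm_sum _ _ _) _.
  apply: (@le_trans _ _ (\sum_(n < N0) `|a (q * n + r)%N|)); last first.
    by rewrite lerDr mulr_ge0 // ltW.
  rewrite -!(big_mkord xpredT (fun n => `|a (q * n + r)%N|)).
  rewrite (@big_cat_nat _ _ _ N 0 N0) ?(ltnW lt_N) //=.
  by rewrite lerDl sumr_ge0.
exists (2 * \sum_(r < q) C r).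
  by rewrite mulr_ge0 // sumr_ge0 // => r _; case: (CP r).
move=> r N; set p := (r %/ q)%N; set r0 := (r %% q)%N.
have r0_lt : (r0 < q)%N by rewrite ltn_mod.
have C_le : C r0 <= \sum_(r < q) C r.
  rewrite (bigD1 (Ordinal r0_lt)) //= lerDl sumr_ge0 // => i _.
  by case: (CP i).
have -> : \sum_(n < N) a (q * n + r)%N =
    \sum_(n < p + N) a (q * n + r0)%N - \sum_(n < p) a (q * n + r0)%N.
  rewrite big_split_ord /= addrAC subrr add0r; apply: eq_bigr => n _.
  by rewrite mulnDr [r in LHS](divn_eq r q) -/p -/r0; congr a; ring.
apply: le_trans (ler_normB _ _) _.
have [_ CP0] := CP r0.
have := CP0 (p + N)%N; have := CP0 p.
by rewrite natrD !mulrDr; lra.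
Qed.

Variables (k : nat) (k_gt1 : (1 < k)%N) (A : automaton k R).

Definition prefix_out (m : nat) (s : state A) : R :=
  out (trans_word s (expansion k_gt1 m)).

Local Notation run := (run k_gt1 (trans (a := A))).

Lemma prefix_out_run (m L n : nat) (s : state A) : (0 < m)%N -> (n < k ^ L)%N ->
  prefix_out m (run L s n) = prefix_out (m * k ^ L + n) s.
Proof.
move=> m_gt0 n_lt; have k_gt0 := ltnW k_gt1.
have div_eq : ((m * k ^ L + n) %/ k ^ L = m)%N.
  by rewrite divnMDl ?expn_gt0 ?k_gt0 // divn_small // addn0.
rewrite /prefix_out [in RHS](@trans_word_run _ _ _ _ L) div_eq //.
by rewrite run_modn.
Qed.

(** The states are finitely many, hence so are the maps [s |-> trans_word s w]. *)
Lemma finitely_many_prefixes : exists m0 : nat, forall m, (0 < m)%N ->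
  exists m' : 'I_m0, prefix_out m =1 prefix_out m'.+1.
Proof.
pose Phi m : {ffun state A -> state A} :=
  [ffun s => trans_word s (expansion k_gt1 m)].
have /choice[c cP] : forall g, exists m', (exists m, (0 < m)%N /\ Phi m = g) ->
    Phi m'.+1 = g.
  move=> g.
  have [[[|m] [// _ <-]]|no] := pselect (exists m, (0 < m)%N /\ Phi m = g).
    by exists m.
  by exists 0%N.
exists (\max_g c g).+1 => m m_gt0.
have lt_c : (c (Phi m) < (\max_g c g).+1)%N by rewrite ltnS leq_bigmax.
exists (Ordinal lt_c) => s /=.
have /(congr1 (fun g : {ffun _ -> _} => g s)) :=
  cP (Phi m) (ex_intro _ m (conj m_gt0 erefl)).
by rewrite !ffunE /prefix_out => ->.
Qed.

Hypothesis A_reached : forall s : state A, reached k_gt1 s.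
Hypothesis A_balanced : balanced (prefix_out^~ (init A)).

(** With [s = run l (init A) i0], the number with low digits [i0], middle digits
    [q * j] and leading digits [m] has value [m * k ^ L * k ^ l + (q * j) * k ^ l
    + i0]: a progression of step [q * k ^ l], whose offset is at most a constant
    times its number of terms times its step. *)
Lemma prefix_out_balanced (m0 : nat) :
  balanced_along_progressions k_gt1 (trans (a := A))
    (fun (i : 'I_m0) s => prefix_out i.+1 s).
Proof.
move=> eps eps_gt0; have k_gt0 := ltnW k_gt1.
pose P (t : 'I_#|state A|.+1 * 'I_m0 * state A) (L : nat) :=
  let: (q, i, s) := t in (0 < q)%N ->
  `|\sum_(j < k ^ L %/ q) prefix_out i.+1 (run L s (q * j))|
     <= eps * (k ^ L %/ q)%:R.
suff [L0 L0P] : exists L0, forall L, (L0 <= L)%N -> forall t, P t L.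
  exists L0 => L le_L q /andP[q_gt0 q_le] i s.
  have q_lt : (q < #|state A|.+1)%N by [].
  exact: (L0P L le_L (Ordinal q_lt, i, s)).
apply: eventually_all => -[[q i] s]; rewrite /P.
have [->|q_gt0] := posnP q; first by exists 0%N.
have [l [i0 [i0_lt s_eq]]] := A_reached s.
set m := i.+1.
have kl_gt0 : (0 < k ^ l)%N by rewrite expn_gt0 k_gt0.
pose eps' := eps / (2 * (4 * m%:R + 5)).
have m_ge1 : 1 <= m%:R :> R by rewrite ler1n.
have eps'_gt0 : 0 < eps' by rewrite divr_gt0 //; lra.
have Q_gt0 : (0 < q * k ^ l)%N by rewrite muln_gt0 q_gt0.
have [C C_ge0 CP] := balanced_sum_le A_balanced Q_gt0 eps'_gt0.
pose J0 := (Num.truncn (2 * C / eps)).+1.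
have J0P : C <= eps / 2 * J0%:R.
  have : 2 * C / eps < J0%:R by rewrite truncnS_gt.
  by rewrite ltr_pdivrMr //; lra.
exists (q * J0)%N => L le_L _.
set J := (k ^ L %/ q)%N.
have J_ge : (J0 <= J)%N.
  rewrite leq_divRL // mulnC (leq_trans le_L) // ltnW //.
  exact: ltn_expl.
set r := (m * k ^ L * k ^ l + i0)%N.
have -> : \sum_(j < J) prefix_out m (run L s (q * j)) =
    \sum_(j < J) prefix_out (q * k ^ l * j + r) (init A).
  apply: eq_bigr => j _.
  have qj_lt : (q * j < k ^ L)%N.
    apply: leq_trans (leq_trunc_div (k ^ L) q).
    by rewrite mulnC ltn_mul2r q_gt0 ltn_ord.
  rewrite prefix_out_run // s_eq prefix_out_run //; last first.
    by rewrite addn_gt0 muln_gt0 expn_gt0 k_gt0.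
  by congr prefix_out; rewrite /r; ring.
apply: le_trans (CP _ _) _.
have r_div : (r %/ (q * k ^ l) <= 2 * m.+1 * J)%N.
  rewrite ltnW // ltn_divLR //.
  have kL_lt : (k ^ L < 2 * J * q)%N.
    apply: leq_trans (ltn_ceil (k ^ L) q_gt0) _.
    rewrite leq_mul2r -/J mul2n -addnn -[J.+1]addn1 leq_add2l.
    by rewrite (leq_trans _ J_ge) // orbT.
  have : (m.+1 * k ^ L * k ^ l < m.+1 * (2 * J * q) * k ^ l)%N.
    by rewrite ltn_mul2r kl_gt0 ltn_mul2l.
  have : (r < m.+1 * k ^ L * k ^ l)%N.
    rewrite /r mulSn mulnDl [ltnRHS]addnC ltn_add2l.
    by apply: leq_trans i0_lt _; rewrite leq_pmull // expn_gt0 k_gt0.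
  move=> /ltn_trans h /h; congr (_ < _)%N; ring.
have {}r_div : (r %/ (q * k ^ l))%:R <= 2 * (m%:R + 1) * J%:R :> R.
  by rewrite natr1 -!natrM ler_nat.
have J_geR : J0%:R <= J%:R :> R by rewrite ler_nat.
have le1 : eps' * (J%:R + 2 * (r %/ (q * k ^ l))%:R) <= eps / 2 * J%:R.
  have -> : eps / 2 * J%:R = eps' * ((4 * m%:R + 5) * J%:R).
    by rewrite /eps'; field; lra.
  by rewrite ler_pM2l //; lra.
have le2 : eps / 2 * J0%:R <= eps / 2 * J%:R by rewrite ler_pM2l //; lra.
by lra.
Qed.

End Balance.

(** Power saving, uniformly over all seminorms. The hypothesis [0 < m] ensures
    that the leading zeros of [n < M ^ j] are not dropped in the expansion of
    [m * M ^ j + n]. *)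
Theorem automatic_block_decay (R : realType) (a : nat -> R) :
  automatic a -> balanced a ->
  exists (M : nat) (rho C : R), [/\ (1 < M)%N, 0 <= rho < 1, 0 <= C &
    forall N, shift_seminorm N -> forall m j : nat, (0 < m)%N ->
      N (\sum_(n < M ^ j) a (m * M ^ j + n)%N *: 'X^n) <=
        C * (rho * M%:R) ^+ j * N 1].
Proof.
move=> [k [k_gt1 [A0 aA0]]] a_bal.
pose A := trim k_gt1 A0.
have aA n : a n = prefix_out k_gt1 n (init A).
  by rewrite aA0 -trim_out.
have A_bal : balanced ((@prefix_out _ _ k_gt1 A)^~ (init A)).
  by rewrite (_ : _ ^~ _ = a) //; apply/funext => n; rewrite aA.
have A_reached : forall s : state A, reached k_gt1 s := @trim_reached _ _ _ _.
have [m0 m0P] := finitely_many_prefixes k_gt1 A.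
have closed (i : 'I_m0) (d : 'I_k) : exists i' : 'I_m0, forall s : state A,
    prefix_out k_gt1 i.+1 (trans s d) = prefix_out k_gt1 i'.+1 s.
  have gt0 : (0 < i.+1 * k ^ 1 + d)%N.
    by rewrite addn_gt0 muln_gt0 expn1 (ltnW k_gt1).
  have [i' i'P] := m0P _ gt0.
  have d_eq : last_digit k_gt1 d = d by apply/val_inj/modn_small.
  by exists i' => s; rewrite -i'P -prefix_out_run ?expn1 // /run d_eq.
have [L [rho [C [L_gt0 rhoP C_ge0 decay]]]] :=
  block_decay (prefix_out_balanced A_reached A_bal m0) closed.
exists (k ^ L)%N, rho, C; split=> //.
  by apply: leq_ltn_trans L_gt0 (ltn_expl L k_gt1).
move=> N hN m j m_gt0; have [i iP] := m0P m m_gt0.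
apply: le_trans (decay N hN i j 1%N (init A)).
rewrite le_eqVlt; apply/orP; left; apply/eqP; congr (N _).
apply: eq_bigr => n _; rewrite mul1n aA -iP prefix_out_run ?expnM //.
Qed.

(** * The seminorm of an orbit *)

Section MeasurePreserving.
Context d (X : measurableType d) (R : realType) (mu : probability X R).
Variable T : X -> X.
Hypothesis T_mp : measure_preserving mu T.

Lemma measurable_mp : measurable_fun setT T. Proof. by case: T_mp. Qed.

Lemma measurable_iter n : measurable_fun setT (iter n T).
Proof.
elim: n => [|n IH]; first exact: measurable_id.
exact: (measurableT_comp measurable_mp IH).
Qed.

Lemma mp_ge0_integral (f : X -> \bar R) : measurable_fun setT f ->
  (forall x, (0 <= f x)%E) -> (\int[mu]_x f (T x) = \int[mu]_x f x)%E.
Proof.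
move=> mf f_ge0.
have /= <- := @ge0_integral_pushforward _ _ X X R T measurable_mp mu setT f
  measurableT mf.
  apply: eq_measure_integral => [|mT A mA _]; first exact: measurable_mp.
  exact: (proj2 T_mp A mA).
by move=> x _.
Qed.

Lemma mp_Rintegral_ge0 (f : X -> R) : measurable_fun setT f ->
  (forall x, 0 <= f x) -> \int[mu]_x f (T x) = \int[mu]_x f x.
Proof.
move=> mf f_ge0; rewrite /Rintegral; congr fine.
apply: (mp_ge0_integral (f := EFin \o f)); first exact/measurable_EFinP.
by move=> x; rewrite lee_fin.
Qed.

Section OrbitPolynomials.
Variables (f : X -> R) (mf : measurable_fun setT f).
Variables (B : R) (fB : forall x, `|f x| <= B).

Definition orbit_eval (p : {poly R}) (x : X) : R :=
  \sum_(i < size p) p`_i * f (iter i T x).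

Lemma orbit_eval_wide (n : nat) (p : {poly R}) (x : X) : (size p <= n)%N ->
  orbit_eval p x = \sum_(i < n) p`_i * f (iter i T x).
Proof.
move=> le_n; rewrite /orbit_eval.
rewrite -!(big_mkord xpredT (fun i => p`_i * f (iter i T x))).
rewrite [RHS](@big_cat_nat _ _ _ (size p)) //= [X in _ = _ + X]big1_seq ?addr0 //.
by move=> i /=; rewrite mem_index_iota => /andP[? _]; rewrite nth_default ?mul0r.
Qed.

Lemma orbit_evalD p q x : orbit_eval (p + q) x = orbit_eval p x + orbit_eval q x.
Proof.
pose n := maxn (size p) (size q).
rewrite !(@orbit_eval_wide n) ?leq_maxl ?leq_maxr ?size_polyD // -big_split /=.
by apply: eq_bigr => i _; rewrite coefD mulrDl.
Qed.

Lemma orbit_evalZ c p x : orbit_eval (c *: p) x = c * orbit_eval p x.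
Proof.
rewrite (@orbit_eval_wide (size p)) ?size_scale_leq // mulr_sumr.
by apply: eq_bigr => i _; rewrite coefZ mulrA.
Qed.

Lemma orbit_eval_shift p x : orbit_eval ('X * p) x = orbit_eval p (T x).
Proof.
rewrite (@orbit_eval_wide (size p).+1); last first.
  by rewrite (leq_trans (size_polyMleq _ _)) // size_polyX.
rewrite big_ord_recl coefXM mul0r add0r; apply: eq_bigr => i _.
by rewrite coefXM /= -iterSr.
Qed.

Lemma orbit_eval1 x : orbit_eval 1 x = f x.
Proof. by rewrite /orbit_eval size_poly1 big_ord1 coef1 mul1r. Qed.

Lemma orbit_evalXn n x : orbit_eval 'X^n x = f (iter n T x).
Proof.
elim: n x => [|n IH] x; first by rewrite expr0 orbit_eval1.
by rewrite exprS orbit_eval_shift IH -iterSr.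
Qed.

Lemma orbit_eval0 x : orbit_eval 0 x = 0.
Proof. by rewrite -(scale0r 0) orbit_evalZ mul0r. Qed.

Lemma orbit_eval_sum (n : nat) (F : nat -> {poly R}) x :
  orbit_eval (\sum_(i < n) F i) x = \sum_(i < n) orbit_eval (F i) x.
Proof.
elim: n => [|n IH]; first by rewrite !big_ord0 orbit_eval0.
by rewrite !big_ord_recr /= orbit_evalD IH.
Qed.

Lemma measurable_orbit_eval p : measurable_fun setT (orbit_eval p).
Proof.
apply: measurable_sum => i.
apply: measurable_funM; first exact: measurable_cst.
exact: (measurableT_comp mf (measurable_iter i)).
Qed.

Lemma orbit_eval_bounded p x :
  `|orbit_eval p x| <= \sum_(i < size p) `|p`_i| * B.
Proof.
apply: le_trans (ler_norm_sum _ _ _) _; apply: ler_sum => i _.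
by rewrite normrM ler_wpM2l.
Qed.

Lemma integrable_orbit_evalM p q :
  mu.-integrable setT (EFin \o (fun x => orbit_eval p x * orbit_eval q x)).
Proof.
apply: measurable_bounded_integrable => //.
- by rewrite (le_lt_trans (probability_le1 _ _)) // ltry.
- by apply: measurable_funM; exact: measurable_orbit_eval.
- exists ((\sum_(i < size p) `|p`_i| * B) * (\sum_(i < size q) `|q`_i| * B)).
  split; first exact: num_real.
  move=> M lt_M x _; rewrite /= normrM; apply: le_trans (ltW lt_M).
  by rewrite ler_pM // orbit_eval_bounded.
Qed.

Definition orbit_dot (p q : {poly R}) : R :=
  \int[mu]_x (orbit_eval p x * orbit_eval q x).

Lemma orbit_dotC p q : orbit_dot p q = orbit_dot q p.
Proof. by apply: eq_Rintegral => x _; rewrite mulrC. Qed.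

Lemma orbit_dotDl p q r : orbit_dot (p + q) r = orbit_dot p r + orbit_dot q r.
Proof.
rewrite /orbit_dot -RintegralD //; [|exact: integrable_orbit_evalM..].
by apply: eq_Rintegral => x _; rewrite orbit_evalD mulrDl.
Qed.

Lemma orbit_dotZl c p q : orbit_dot (c *: p) q = c * orbit_dot p q.
Proof.
rewrite /orbit_dot -RintegralZl //; last exact: integrable_orbit_evalM.
by apply: eq_Rintegral => x _; rewrite orbit_evalZ mulrA.
Qed.

Lemma orbit_dot_ge0 p : 0 <= orbit_dot p p.
Proof. by apply: Rintegral_ge0 => x _; rewrite -expr2 sqr_ge0. Qed.

Definition orbit_norm (p : {poly R}) : R := Num.sqrt (orbit_dot p p).

Lemma orbit_norm_sqr p : orbit_norm p ^+ 2 = orbit_dot p p.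
Proof. by rewrite sqr_sqrtr // orbit_dot_ge0. Qed.

Lemma orbit_dot_comb s t p q :
  orbit_dot (s *: p + t *: q) (s *: p + t *: q) =
  s ^+ 2 * orbit_dot p p + 2 * s * t * orbit_dot p q + t ^+ 2 * orbit_dot q q.
Proof.
rewrite orbit_dotDl !orbit_dotZl !(orbit_dotC _ (_ + _)) !orbit_dotDl !orbit_dotZl.
by rewrite (orbit_dotC q p); ring.
Qed.

Lemma orbit_cauchy_schwarz p q : orbit_dot p q <= orbit_norm p * orbit_norm q.
Proof.
have ge0 r : 0 <= orbit_norm r by exact: sqrtr_ge0.
(* The form may be degenerate, so the vectors of norm 0 are treated apart: the
   two combinations below would have a negative square. *)
have [a0|a_neq0] := eqVneq (orbit_norm p * orbit_norm q) 0.
  rewrite a0 leNgt; apply/negP => dot_gt0.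
  have := orbit_norm_sqr p; have := orbit_norm_sqr q.
  move/eqP : a0; rewrite mulf_eq0 => /orP[] /eqP ->; rewrite expr0n /= => h1 h2.
  - have := orbit_dot_ge0 ((orbit_dot q q + 1) *: p + (- orbit_dot p q) *: q).
    rewrite orbit_dot_comb -h2; have := orbit_dot_ge0 q; nra.
  - have := orbit_dot_ge0 ((- orbit_dot p q) *: p + (orbit_dot p p + 1) *: q).
    rewrite orbit_dot_comb -h1; have := orbit_dot_ge0 p; nra.
have a_gt0 : 0 < orbit_norm p * orbit_norm q by rewrite lt_neqAle eq_sym a_neq0 mulr_ge0.
have := orbit_dot_ge0 (orbit_norm q *: p + (- orbit_norm p) *: q).
rewrite orbit_dot_comb -!orbit_norm_sqr => h.
rewrite -subr_ge0 -(pmulr_rge0 _ a_gt0).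
by move: h; nra.
Qed.

(** Shift invariance is the invariance of the measure; the other properties hold
    for the norm of any positive semidefinite symmetric form. *)
Lemma orbit_shift_seminorm : shift_seminorm orbit_norm.
Proof.
have ge0 r : 0 <= orbit_norm r by exact: sqrtr_ge0.
split=> [//|p q|c p|p q|p].
- rewrite -(@ler_pXn2r _ 2) ?nnegrE ?addr_ge0 //.
  rewrite orbit_norm_sqr -[p in X in X <= _]scale1r -[q in X in X <= _]scale1r.
  rewrite orbit_dot_comb sqrrD !orbit_norm_sqr.
  have := orbit_cauchy_schwarz p q; lra.
- rewrite /orbit_norm orbit_dotZl orbit_dotC orbit_dotZl mulrA -expr2.
  by rewrite sqrtrM ?sqr_ge0 // sqrtr_sqr.
- rewrite !orbit_norm_sqr.
  have := orbit_dot_comb 1 1 p q; have := orbit_dot_comb 1 (-1) p q.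
  rewrite !scale1r scaleN1r => -> ->; ring.
- congr (Num.sqrt _).
  rewrite /orbit_dot; under eq_Rintegral do rewrite orbit_eval_shift.
  apply: (mp_Rintegral_ge0 (f := fun x => orbit_eval p x * orbit_eval p x)).
    by apply: measurable_funM; exact: measurable_orbit_eval.
  by move=> x; rewrite -expr2 sqr_ge0.
Qed.

End OrbitPolynomials.
End MeasurePreserving.

(** * Almost everywhere convergence for bounded functions *)

(** By monotone convergence the sum of the [g j] has a finite integral, so it is
    finite almost everywhere and its terms tend to 0. *)
Lemma summable_ae_cvg0 d (X : measurableType d) (R : realType)
    (mu : probability X R) (g : nat -> X -> R) (K r : R) :
    (forall j, measurable_fun setT (g j)) -> (forall j x, 0 <= g j x) ->
    0 <= K -> 0 <= r < 1 ->
    (forall j, (\int[mu]_x (g j x)%:E <= (K * r ^+ j)%:E)%E) ->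
  {ae mu, forall x, g ^~ x @ \oo --> (0 : R)}.
Proof.
move=> mg g_ge0 K_ge0 /andP[r_ge0 r_lt1] int_le.
pose G x := (\sum_(0 <= j <oo) (g j x)%:E)%E.
have G_ge0 x : (0 <= G x)%E by apply: nneseries_ge0 => j _ _; rewrite lee_fin.
have mG : measurable_fun setT G.
  apply: ge0_emeasurable_sum => [j x _ _|j _]; first by rewrite lee_fin.
  exact/measurable_EFinP.
have int_G : (\int[mu]_x G x <= (K / (1 - r))%:E)%E.
  rewrite integral_nneseries //; last 2 first.
  - by move=> j; exact/measurable_EFinP.
  - by move=> j x _; rewrite lee_fin.
  apply: lime_le.
    apply: is_cvg_nneseries => j _ _.
    by apply: integral_ge0 => x _; rewrite lee_fin.
  apply: nearW => n; apply: le_trans (lee_sum _ (fun j _ => int_le j)) _.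
  rewrite sumEFin lee_fin.
  have -> : \sum_(0 <= j < n) K * r ^+ j = series (geometric K r) n by [].
  rewrite geometric_seriesE; last by rewrite lt_eqF.
  rewrite ler_pM2r ?invr_gt0 ?subr_gt0 // ler_piMr // gerBl exprn_ge0 //.
have G_int : mu.-integrable setT G.
  apply/integrableP; split=> //.
  under eq_integral do rewrite gee0_abs //.
  exact: le_lt_trans int_G (ltry _).
apply: filterS (integrable_ae measurableT G_int) => x /(_ I) G_fin.
apply: cvg_series_cvg_0; apply: nondecreasing_is_cvgn.
  apply/nondecreasing_seqP => n; rewrite /series /= big_nat_recr //=.
  by rewrite lerDl.
exists (fine (G x)) => _ [n _ <-].
rewrite -lee_fin fineK // /series /= -sumEFin.
by apply: nneseries_lim_ge => j _ _; rewrite lee_fin.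
Qed.

(** Cut [0, N) into [m] blocks of length [M ^ L], with [m] between [M ^ r] and
    [M ^ r.+1], and a shorter remainder. For [r] fixed, only finitely many block
    numbers occur, so the means over all the blocks but the first are uniformly
    small for large [N]; the first block and the remainder make up a proportion
    at most [2 / M ^ r] of the terms. *)
Lemma block_means_cvg0 (R : realType) (M : nat) (D : R) (c : nat -> R) :
    (1 < M)%N -> (forall n, `|c n| <= D) ->
    (forall m, (0 < m)%N ->
      (fun j => (M ^ j)%:R^-1 * \sum_(n < M ^ j) c (m * M ^ j + n)%N) @ \oo
        --> (0 : R)) ->
  (fun N => N%:R^-1 * \sum_(n < N) c n) @ \oo --> (0 : R).
Proof.
move=> M_gt1 cD blocks; have M_gt0 := ltnW M_gt1.
have D_ge0 : 0 <= D := le_trans (normr_ge0 _) (cD 0%N).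
apply/cvgr0Pnorm_le => eps eps_gt0.
pose r := (Num.truncn (4 * D / eps)).+1.
have r_gt : 4 * D < eps * r%:R.
  have : 4 * D / eps < r%:R by rewrite truncnS_gt.
  by rewrite ltr_pdivrMr // [eps * _]mulrC.
pose eta := eps / 2.
have eta_gt0 : 0 < eta by rewrite divr_gt0.
have [L0 L0P] : exists L0, forall L, (L0 <= L)%N ->
    forall m : 'I_(M ^ r.+1), (0 < m)%N ->
    `|\sum_(n < M ^ L) c (m * M ^ L + n)%N| <= eta * (M ^ L)%:R.
  apply: eventually_all => m; have [->|m_gt0] := posnP m; first by exists 0%N.
  have /cvgr0Pnorm_le /(_ eta eta_gt0) [L0 _ L0P] := blocks m m_gt0.
  exists L0 => L /L0P /=; rewrite normrM normfV [ `|_%:R|]ger0_norm //.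
  by rewrite mulrC ler_pdivrMr // ltr0n expn_gt0 M_gt0.
exists (M ^ (L0 + r))%N => // N /= le_N.
have N_gt0 : (0 < N)%N by rewrite (leq_trans _ le_N) // expn_gt0 M_gt0.
have /andP[tl_le tl_gt] := trunc_log_bounds M_gt1 N_gt0.
set t := trunc_log M N in tl_le tl_gt.
have t_ge : (L0 + r <= t)%N.
  rewrite -ltnS -(ltn_exp2l _ _ M_gt1); exact: leq_ltn_trans tl_gt.
pose L := (t - r)%N.
have L_ge : (L0 <= L)%N by rewrite leq_subRL ?(leq_trans _ t_ge) ?leq_addl // addnC.
have t_eq : t = (r + L)%N by rewrite subnKC // (leq_trans _ t_ge) ?leq_addl.
have ML_gt0 : (0 < M ^ L)%N by rewrite expn_gt0 M_gt0.
pose m := (N %/ M ^ L)%N.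
have m_ge : (M ^ r <= m)%N by rewrite leq_divRL // -expnD -t_eq.
have m_lt : (m < M ^ r.+1)%N by rewrite ltn_divLR // -expnD addSn -t_eq.
have r_lt_m : r%:R <= m%:R :> R.
  by rewrite ler_nat (leq_trans _ m_ge) // ltnW // ltn_expl.
have m_gt0 : (0 < m)%N by rewrite (leq_trans _ m_ge) // expn_gt0 M_gt0.
have short (F : nat -> R) (n : nat) : (forall i, `|F i| <= D) ->
    (n <= M ^ L)%N -> `|\sum_(i < n) F i| <= D * (M ^ L)%:R.
  move=> FD le_n; apply: le_trans (ler_norm_sum _ _ _) _.
  apply: le_trans (ler_sum _ (fun (i : 'I_n) _ => FD i)) _.
  by rewrite sumr_const card_ord -[D *+ n]mulr_natr ler_wpM2l // ler_nat.
have sum_le : `|\sum_(n < N) c n| <= (2 * D + eta * m%:R) * (M ^ L)%:R.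
  rewrite [N in X in `|X|](divn_eq N (M ^ L)) -/m big_split_ord /=.
  rewrite (sum_nat_mul c m (M ^ L)).
  have rest := short (fun i => c (m * M ^ L + i)%N) (N %% M ^ L)%N
    (fun i => cD _) (ltnW (ltn_pmod _ ML_gt0)).
  apply: le_trans (ler_normD _ _) _.
  suff blocks_le : `|\sum_(i < m) \sum_(j < M ^ L) c (i * M ^ L + j)%N| <=
      D * (M ^ L)%:R + eta * m%:R * (M ^ L)%:R.
    by move: rest blocks_le; lra.
  case: (m) m_gt0 m_lt => // m' _ m'_lt.
  rewrite big_ord_recl; apply: le_trans (ler_normD _ _) _; apply: lerD.
    by apply: (short (fun j => c (0 * M ^ L + j)%N)).
  apply: le_trans (ler_norm_sum _ _ _) _.
  apply: (@le_trans _ _ (\sum_(i < m') eta * (M ^ L)%:R)).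
    apply: ler_sum => i _.
    have i_lt : (@lift m'.+1 ord0 i < M ^ r.+1)%N by exact: ltn_trans (ltn_ord _) m'_lt.
    exact: (L0P L L_ge (Ordinal i_lt)).
  rewrite sumr_const card_ord -[_ *+ m']mulr_natr mulrAC ler_wpM2r // ler_wpM2l ?ler_nat //.
  exact: ltW.
rewrite normrM normfV [ `|_%:R|]ger0_norm // mulrC ler_pdivrMr ?ltr0n //.
apply: le_trans sum_le _.
have mM_le : m%:R * (M ^ L)%:R <= N%:R :> R by rewrite -natrM ler_nat leq_trunc_div.
apply: (@le_trans _ _ (eps * (m%:R * (M ^ L)%:R))); last by rewrite ler_pM2l.
rewrite mulrA ler_wpM2r //.
have : eps * r%:R <= eps * m%:R by rewrite ler_pM2l.
by rewrite /eta; lra.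
Qed.

Section BoundedFunctions.
Context d (X : measurableType d) (R : realType) (mu : probability X R).
Variable T : X -> X.
Hypothesis T_mp : measure_preserving mu T.
Variables (a : nat -> R) (D : R).
Hypotheses (a_automatic : automatic a) (a_balanced : balanced a).
Hypothesis (aD : forall n, `|a n| <= D).

(** The block means with [m] fixed decay geometrically in L^2, so they tend to 0
    almost everywhere. *)
Lemma bounded_weighted_ergodic (f : X -> R) (B : R) :
    measurable_fun setT f -> (forall x, `|f x| <= B) ->
  {ae mu, forall x,
    (fun N => N%:R^-1 * \sum_(n < N) a n * f (iter n T x)) @ \oo --> (0 : R)}.
Proof.
move=> mf fB.
have [M [rho [C [M_gt1 /andP[rho_ge0 rho_lt1] C_ge0 decay]]]] :=
  automatic_block_decay a_automatic a_balanced.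
have hN := orbit_shift_seminorm T_mp mf fB.
pose P m j : {poly R} :=
  (M ^ j)%:R^-1 *: ('X^(m * M ^ j) * \sum_(n < M ^ j) a (m * M ^ j + n)%N *: 'X^n).
have P_eval m j x : orbit_eval T f (P m j) x =
    (M ^ j)%:R^-1 * \sum_(n < M ^ j) a (m * M ^ j + n)%N * f (iter (m * M ^ j + n) T x).
  rewrite orbit_evalZ; congr (_ * _); rewrite mulr_sumr.
  under eq_bigr => n _ do rewrite -scalerAr -exprD.
  rewrite (orbit_eval_sum _ _ _ (fun n => a (m * M ^ j + n)%N *: 'X^(m * M ^ j + n))).
  by apply: eq_bigr => n _; rewrite orbit_evalZ orbit_evalXn.
have Mj_gt0 j : 0 < (M ^ j)%:R :> R by rewrite ltr0n expn_gt0 (ltnW M_gt1).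
have P_norm m j : (0 < m)%N ->
    orbit_norm mu T f (P m j) <= C * rho ^+ j * orbit_norm mu T f 1.
  move=> m_gt0; rewrite (sn_scale hN) (sn_shiftX hN) ger0_norm; last by rewrite invr_ge0 ltW.
  rewrite ler_pdivrMl //; apply: le_trans (decay _ hN m j m_gt0) _.
  by rewrite exprMn natrX le_eqVlt; apply/orP; left; apply/eqP; ring.
have ae_m m : {ae mu, forall x, (0 < m)%N -> orbit_eval T f (P m j) x @[j --> \oo] --> (0 : R)}.
  have [->|m_gt0] := posnP m; first exact: aeW.
  set K := (C * orbit_norm mu T f 1) ^+ 2.
  have rho2 : 0 <= rho ^+ 2 < 1 by rewrite sqr_ge0 expr_lt1.
  have K_ge0 : 0 <= K by rewrite sqr_ge0.
  have := @summable_ae_cvg0 _ X R mu (fun j x => orbit_eval T f (P m j) x ^+ 2)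
    K (rho ^+ 2) _ (fun j x => sqr_ge0 _) K_ge0 rho2.
  have mE j : measurable_fun setT (fun x => orbit_eval T f (P m j) x ^+ 2).
    by apply: measurable_funX; exact: (measurable_orbit_eval T_mp mf).
  have int_le j : (\int[mu]_x (orbit_eval T f (P m j) x ^+ 2)%:E <=
      (K * (rho ^+ 2) ^+ j)%:E)%E.
    have int := integrable_orbit_evalM T_mp mf fB (P m j) (P m j).
    under eq_integral do rewrite expr2.
    rewrite -(fineK (integrable_fin_num measurableT int)) lee_fin.
    rewrite -[leLHS]/(orbit_dot mu T f (P m j) (P m j)).
    rewrite -(orbit_norm_sqr mu T f) /K -exprM mulnC exprM -exprMn.
    rewrite lerXn2r ?nnegrE ?sqrtr_ge0 ?mulr_ge0 ?exprn_ge0 ?sqrtr_ge0 //.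
    by rewrite mulrAC; exact: P_norm.
  move=> /(_ mE int_le); apply: filterS => x sq_cvg _.
  apply/cvgr0Pnorm_lt => eps eps_gt0.
  have eps2_gt0 : 0 < eps ^+ 2 by rewrite exprn_gt0.
  move/cvgr0Pnorm_lt : sq_cvg => /(_ _ eps2_gt0).
  apply: filterS => j; rewrite normrX => h.
  by rewrite -(@ltr_pXn2r _ 2) ?nnegrE // ltW.
move: (ae_foralln ae_m); apply: filterS => x all_m.
apply: (@block_means_cvg0 R M (D * B) (fun n => a n * f (iter n T x))) => // [n|m m_gt0].
  by rewrite normrM ler_pM.
rewrite (_ : (fun j => _) = (fun j => orbit_eval T f (P m j) x)); first exact: all_m.
by apply/funext => j; rewrite P_eval.
Qed.

End BoundedFunctions.

(** * The maximal ergodic inequality *)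

Section MaximalInequality.
Context d (X : measurableType d) (R : realType) (mu : probability X R).
Variable T : X -> X.
Hypothesis T_mp : measure_preserving mu T.
Variables (h : X -> R) (lam : R).
Hypotheses (mh : measurable_fun setT h) (h_ge0 : forall x, 0 <= h x).
Hypothesis lam_ge0 : 0 <= lam.

(** The maximum over [n <= N] of [\sum_(i < n) (h (iter i T x) - lam)]. In this
    recursive form the inequality of Garsia is immediate: where the maximum is
    positive, it is [h x - lam] plus the maximum of one term fewer at [T x]. *)
Fixpoint max_excess (N : nat) (x : X) : R :=
  if N is N'.+1 then Num.max 0 (h x - lam + max_excess N' (T x)) else 0.

Lemma max_excess_ge0 N x : 0 <= max_excess N x.
Proof. by case: N => [|N] //=; rewrite le_max lexx. Qed.

Lemma max_excess_leS N x : max_excess N x <= max_excess N.+1 x.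
Proof.
elim: N x => [|N IH] x; first exact: max_excess_ge0.
by rewrite /= ge_max !le_max lexx /= lerD2l IH orbT.
Qed.

Lemma max_excess_homo x : {homo (max_excess^~ x) : m n / (m <= n)%N >-> m <= n}.
Proof. by apply/nondecreasing_seqP => n; exact: max_excess_leS. Qed.

Lemma sum_le_max_excess N x :
  \sum_(n < N) h (iter n T x) <= lam * N%:R + max_excess N x.
Proof.
elim: N x => [|N IH] x; first by rewrite big_ord0 mulr0 addr0.
rewrite big_ord_recl /=; under eq_bigr do rewrite -iterS iterSr.
have := IH (T x).
have : h x - lam + max_excess N (T x) <= max_excess N.+1 x.
  by rewrite /= le_max lexx orbT.
by rewrite [N.+1%:R]mulrS /= mulrDr mulr1; lra.
Qed.

Lemma measurable_max_excess N : measurable_fun setT (max_excess N).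
Proof.
elim: N => [|N IH] /=; first exact: measurable_cst.
apply: (measurable_maxr (f := cst 0) (g := fun x => h x - lam + max_excess N (T x))).
  exact: measurable_cst.
apply: measurable_funD; last exact: (measurableT_comp IH (measurable_mp T_mp)).
by apply: measurable_funB => //; exact: measurable_cst.
Qed.

Lemma integral_max_excess_fin N : (\int[mu]_x (h x)%:E < +oo)%E ->
  (\int[mu]_x (max_excess N x)%:E < +oo)%E.
Proof.
move=> h_fin; elim: N => [|N IH].
  by under eq_integral do rewrite /=; rewrite integral0 ltry.
have mN := measurable_max_excess N.
have mNT : measurable_fun setT (fun x => (max_excess N (T x))%:E).
  apply/measurable_EFinP; exact: (measurableT_comp mN (measurable_mp T_mp)).
have ge0 n x : (0 <= (max_excess n x)%:E)%E by rewrite lee_fin max_excess_ge0.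
have h_ge0' x : (0 <= (h x)%:E)%E by rewrite lee_fin.
have int_shift : (\int[mu]_x (max_excess N (T x))%:E = \int[mu]_x (max_excess N x)%:E)%E.
  apply: (mp_ge0_integral T_mp (f := fun x => (max_excess N x)%:E)) => //.
  exact/measurable_EFinP.
apply: (@le_lt_trans _ _ (\int[mu]_x ((h x)%:E + (max_excess N (T x))%:E))%E).
  apply: ge0_le_integral => //.
  - by apply/measurable_EFinP; exact: measurable_max_excess.
  - by apply: emeasurable_funD => //; exact/measurable_EFinP.
  - move=> x _; rewrite -EFinD lee_fin /= ge_max addr_ge0 ?max_excess_ge0 //=.
    by rewrite lerD2r gerBl.
rewrite ge0_integralD //; last exact/measurable_EFinP.
by rewrite int_shift lte_add_pinfty.
Qed.

Let exceeds N := [set x | 0 < max_excess N x].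

Lemma measurable_exceeds N : measurable (exceeds N).
Proof.
have : measurable_fun setT (fun x => 0 < max_excess N x).
  apply: measurable_fun_ltr; [exact: measurable_cst|exact: measurable_max_excess].
by move=> /(_ measurableT [set true] I); rewrite setTI.
Qed.

(** Pointwise, [lam * \1_E + M <= h + M \o T], where [M] is the maximal excess
    and [E] the set where it is positive. As [T] preserves the measure, the
    integrals of [M] and [M \o T] are equal, and they are finite, so they
    cancel. *)
Lemma maximal_ergodic_step N : (\int[mu]_x (h x)%:E < +oo)%E ->
  (lam%:E * mu (exceeds N.+1) <= \int[mu]_x (h x)%:E)%E.
Proof.
move=> h_fin; set E := exceeds N.+1; set M := max_excess N.+1.
have mE : measurable E := measurable_exceeds N.+1.
have mM : measurable_fun setT (fun x => (M x)%:E).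
  by apply/measurable_EFinP; exact: measurable_max_excess.
have mMT : measurable_fun setT (fun x => (M (T x))%:E).
  apply/measurable_EFinP.
  exact: (measurableT_comp (measurable_max_excess N.+1) (measurable_mp T_mp)).
have m1 : measurable_fun setT (fun x => (\1_E x : R)%:E).
  by apply/measurable_EFinP; exact: measurable_indic.
have mlam1 : measurable_fun setT (fun x => lam%:E * (\1_E x : R)%:E)%E.
  by apply: emeasurable_funM => //; exact: measurable_cst.
have mhE : measurable_fun setT (fun x => (h x)%:E) by exact/measurable_EFinP.
have M_ge0 x : (0 <= (M x)%:E)%E by rewrite lee_fin max_excess_ge0.
have h_ge0' x : (0 <= (h x)%:E)%E by rewrite lee_fin.
have ind_ge0 x : (0 <= (\1_E x : R)%:E)%E by rewrite lee_fin.
have lam1_ge0 x : (0 <= lam%:E * (\1_E x : R)%:E)%E by rewrite mule_ge0 // lee_fin.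
have pointwise x : (lam%:E * (\1_E x)%:E + (M x)%:E <= (h x)%:E + (M (T x))%:E)%E.
  rewrite -EFinM -!EFinD lee_fin indicE.
  have leS := max_excess_leS N (T x); rewrite -/M in leS.
  have [xE|xE] := boolP (x \in E).
    rewrite mulr1; move: xE; rewrite inE /E /exceeds /M /= lt_max ltxx /= => gt0.
    rewrite (max_idPr _) ?(ltW gt0) //; move: leS; rewrite /M /=; lra.
  have -> : M x = 0.
    apply/eqP; rewrite eq_le max_excess_ge0 andbT leNgt; apply/negP => Mx.
    by move/negP: xE; apply; rewrite inE.
  by rewrite mulr0 addr0 addr_ge0 // max_excess_ge0.
have M_fin : (\int[mu]_x (M x)%:E \is a fin_num)%E.
  rewrite ge0_fin_numE; last by apply: integral_ge0.
  exact: integral_max_excess_fin.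
have int_shift : (\int[mu]_x (M (T x))%:E = \int[mu]_x (M x)%:E)%E.
  exact: (mp_ge0_integral T_mp (f := fun x => (M x)%:E)).
have : (\int[mu]_x (lam%:E * (\1_E x)%:E + (M x)%:E) <=
        \int[mu]_x ((h x)%:E + (M (T x))%:E))%E.
  apply: ge0_le_integral => //.
  - by move=> x _; rewrite adde_ge0.
  - exact: emeasurable_funD.
  - exact: emeasurable_funD.
rewrite !ge0_integralD // int_shift leeD2rE // ge0_integralZl //.
by rewrite integral_indic // setIT.
Qed.

Lemma maximal_ergodic_inequality : (\int[mu]_x (h x)%:E < +oo)%E ->
  exists E : set X, [/\ measurable E,
    (lam%:E * mu E <= \int[mu]_x (h x)%:E)%E &
    forall x, ~ E x -> forall N, \sum_(n < N) h (iter n T x) <= lam * N%:R].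
Proof.
move=> h_fin; exists (\bigcup_N exceeds N.+1).
have mE : measurable (\bigcup_N exceeds N.+1).
  by apply: bigcup_measurable => N _; exact: measurable_exceeds.
split=> // [|x notE N].
  have cvg_mu : (mu (exceeds N.+1) @[N --> \oo] --> mu (\bigcup_N exceeds N.+1))%classic.
    apply: nondecreasing_cvg_mu => // [N|m n le_mn]; first exact: measurable_exceeds.
    apply/subsetPset => x gt0; apply: (lt_le_trans gt0).
    exact: (@max_excess_homo x m.+1 n.+1).
  have : (lam%:E * mu (exceeds N.+1) @[N --> \oo] --> lam%:E * mu (\bigcup_N exceeds N.+1))%E.
    exact: cvgeZl.
  move=> cvg_lam; rewrite -(cvg_lim _ cvg_lam) //.
  apply: lime_le; first by apply/cvg_ex; exists (lam%:E * mu (\bigcup_N exceeds N.+1))%E.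
  by apply: nearW => N; exact: maximal_ergodic_step.
case: N => [|N]; first by rewrite big_ord0 mulr0.
have := sum_le_max_excess N.+1 x.
suff -> : max_excess N.+1 x = 0 by rewrite addr0.
apply/eqP; rewrite eq_le max_excess_ge0 andbT leNgt; apply/negP => gt0.
by apply: notE; exists N.
Qed.

End MaximalInequality.

(** * Integrable functions *)

Section IntegrableFunctions.
Context d (X : measurableType d) (R : realType) (mu : probability X R).
Variable T : X -> X.
Hypothesis T_mp : measure_preserving mu T.

Definition clip (k : nat) (y : R) : R := Num.max (- k%:R) (Num.min k%:R y).

Lemma clip_bounded k y : `|clip k y| <= k%:R.
Proof.
have k_ge0 : 0 <= k%:R :> R by rewrite ler0n.
by rewrite ler_norml /clip le_max lexx ge_max ge_min lexx /= andbT; lra.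
Qed.

Lemma clip_id k y : `|y| <= k%:R -> clip k y = y.
Proof.
by rewrite ler_norml => /andP[ge_y le_y]; rewrite /clip (min_idPr le_y) (max_idPr ge_y).
Qed.

Lemma clip_dist_le k y : `|y - clip k y| <= `|y|.
Proof.
have k_ge0 : 0 <= k%:R :> R by rewrite ler0n.
rewrite /clip; case: (lerP k%:R y) => hy.
  rewrite (max_idPr _); last by lra.
  by rewrite !ger0_norm //; lra.
case: (lerP (- k%:R) y) => hy'; first by rewrite subrr normr0.
by rewrite !ler0_norm //; lra.
Qed.

Lemma measurable_clip k (f : X -> R) : measurable_fun setT f ->
  measurable_fun setT (fun x => clip k (f x)).
Proof.
move=> mf.
apply: (measurable_maxr (f := cst (- k%:R)) (g := fun x => Num.min k%:R (f x))) => //.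
exact: (measurable_minr (f := cst k%:R)).
Qed.

Section Truncation.
Variable f : X -> R.
Hypothesis f_int : mu.-integrable setT (EFin \o f).

Let mf : measurable_fun setT f.
Proof. exact/measurable_EFinP/(measurable_int _ f_int). Qed.

Lemma measurable_clip_error k : measurable_fun setT (fun x => `|f x - clip k (f x)|).
Proof.
apply: measurableT_comp => //; apply: measurable_funB => //; exact: measurable_clip.
Qed.

Lemma integral_clip_error_cvg0 :
  (\int[mu]_x `|f x - clip k (f x)|%:E)%E @[k --> \oo] --> (0%R : R)%:E.
Proof.
have := @dominated_cvg _ X R mu setT measurableT
  (fun k x => `|f x - clip k (f x)|%:E) (cst 0%E) (fun x => `|f x|%:E).
rewrite integral_cst // mul0e; apply => //.
- by move=> k; apply/measurable_EFinP; exact: measurable_clip_error.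
- move=> x _; apply: cvg_near_cst.
  exists (Num.truncn `|f x|).+1 => // k /= le_k.
  rewrite clip_id ?subrr ?normr0 //; apply: ltW.
  by apply: (lt_le_trans (truncnS_gt _)); rewrite ler_nat.
- exact: integrable_norm.
- by move=> k x _; rewrite abse_EFin normr_id lee_fin clip_dist_le.
Qed.

(** By the maximal inequality the exceptional set for the level [k] has measure
    at most [lam^-1] times the integral of the clipping error, which tends to 0;
    the intersection of these sets over [k] is therefore null. *)
Lemma ae_small_clip_error (lam : R) : 0 < lam ->
  {ae mu, forall x, exists k, forall N,
    \sum_(n < N) `|f (iter n T x) - clip k (f (iter n T x))| <= lam * N%:R}.
Proof.
move=> lam_gt0.
have err_fin k : (\int[mu]_x `|f x - clip k (f x)|%:E < +oo)%E.
  have /integrableP[_] := f_int; apply: le_lt_trans.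
  apply: ge0_le_integral => //.
  - by apply/measurable_EFinP; exact: measurable_clip_error.
  - by apply/measurable_EFinP; exact: measurableT_comp.
  - by move=> x _; rewrite abse_EFin lee_fin clip_dist_le.
have /choice[E EP] k := maximal_ergodic_inequality T_mp (measurable_clip_error k)
  (fun x => normr_ge0 _) (ltW lam_gt0) (err_fin k).
have mE k : measurable (E k) by case: (EP k).
have mcap : measurable (\bigcap_k E k).
  by apply: bigcap_measurable => //; exists 0%N.
exists (\bigcap_k E k); split=> //.
  have : (lam%:E * mu (\bigcap_k E k) <= (0%R : R)%:E)%E.
    rewrite -[leRHS](cvg_lim _ integral_clip_error_cvg0) //.
    apply: lime_ge.
      by apply/cvg_ex; exists (0%R)%:E; exact: integral_clip_error_cvg0.
    apply: nearW => k; have [_ + _] := EP k; apply: le_trans.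
    rewrite lee_pmul2l // ?lte_fin // le_measure ?inE //.
    exact: bigcap_inf.
  rewrite pmule_rle0 ?lte_fin // => mu_le0.
  by apply/eqP; rewrite eq_le mu_le0 measure_ge0.
move=> x /=; apply: contra_notP => not_cap.
have [k notE] : exists k, ~ E k x.
  by apply: contrapT => all; apply: not_cap => k _; apply: contrapT => no; apply: all; exists k.
by exists k; case: (EP k) => _ _; apply.
Qed.

End Truncation.

(** Clip [f] at a level [k]: the clipped part is bounded, and the error
    contributes at most [D * lam] in the limit. The level may depend on [x], since
    countably many null sets take care of all levels at once. *)
Lemma integrable_weighted_ergodic (a : nat -> R) (D : R) (f : X -> R) :
    automatic a -> balanced a -> (forall n, `|a n| <= D) ->
    mu.-integrable setT (EFin \o f) ->
  {ae mu, forall x,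
    (fun N => N%:R^-1 * \sum_(n < N) a n * f (iter n T x)) @ \oo --> (0 : R)}.
Proof.
move=> a_auto a_bal aD f_int.
have D_ge0 : 0 <= D := le_trans (normr_ge0 _) (aD 0%N).
have mf : measurable_fun setT f by exact/measurable_EFinP/(measurable_int _ f_int).
have clipped k : {ae mu, forall x,
    (fun N => N%:R^-1 * \sum_(n < N) a n * clip k (f (iter n T x))) @ \oo --> (0 : R)}.
  apply: (bounded_weighted_ergodic T_mp a_auto a_bal aD (f := fun x => clip k (f x)) (B := k%:R)).
    exact: measurable_clip.
  by move=> x; exact: clip_bounded.
have lam_gt0 i : 0 < i.+1%:R^-1 :> R by rewrite invr_gt0 ltr0n.
have errors i := ae_small_clip_error f_int (lam_gt0 i).
move: (ae_foralln errors); move: (ae_foralln clipped).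
apply: filterS2 => x clip_cvg err_small.
apply/cvgr0Pnorm_le => eps eps_gt0.
pose i := Num.truncn (2 * D / eps).
have i_gt : 2 * D < eps * i.+1%:R.
  have : 2 * D / eps < i.+1%:R by rewrite truncnS_gt.
  by rewrite ltr_pdivrMr // [eps * _]mulrC.
have [k kP] := err_small i.
have eps2 : 0 < eps / 2 by rewrite divr_gt0.
have /cvgr0Pnorm_le /(_ _ eps2) := clip_cvg k.
apply: filterS => N clip_le.
have [->|N_gt0] := posnP N; first by rewrite big_ord0 mulr0 normr0 ltW.
have NR_gt0 : 0 < N%:R :> R by rewrite ltr0n.
have -> : N%:R^-1 * \sum_(n < N) a n * f (iter n T x) =
    N%:R^-1 * (\sum_(n < N) a n * clip k (f (iter n T x))) +
    N%:R^-1 * (\sum_(n < N) a n * (f (iter n T x) - clip k (f (iter n T x)))).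
  rewrite -mulrDr -big_split /=; congr (_ * _); apply: eq_bigr => n _; ring.
apply: le_trans (ler_normD _ _) _.
suff : `|N%:R^-1 * (\sum_(n < N) a n * (f (iter n T x) - clip k (f (iter n T x))))| <= eps / 2.
  by move: clip_le; lra.
rewrite normrM normfV [ `|N%:R|]ger0_norm // ler_pdivrMl //.
apply: le_trans (ler_norm_sum _ _ _) _.
apply: (@le_trans _ _ (D * \sum_(n < N) `|f (iter n T x) - clip k (f (iter n T x))|)).
  by rewrite mulr_sumr; apply: ler_sum => n _; rewrite normrM ler_wpM2r.
apply: (@le_trans _ _ (D * (i.+1%:R^-1 * N%:R))); first by rewrite ler_wpM2l.
rewrite mulrA [leRHS]mulrC ler_pM2r // ler_pdivrMr ?ltr0n //; lra.
Qed.

End IntegrableFunctions.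

(** * Complex values *)

Section ComplexSequences.
Variable R : realType.

Lemma Re_sum (n : nat) (x : nat -> R[i]) :
  complex.Re (\sum_(i < n) x i) = \sum_(i < n) complex.Re (x i).
Proof. by apply: (big_morph (@complex.Re R)) => // -[? ?] [? ?]. Qed.

Lemma Im_sum (n : nat) (x : nat -> R[i]) :
  complex.Im (\sum_(i < n) x i) = \sum_(i < n) complex.Im (x i).
Proof. by apply: (big_morph (@complex.Im R)) => // -[? ?] [? ?]. Qed.

Lemma averageE (x : nat -> R[i]) (N : nat) :
  average x N = (N%:R^-1 * \sum_(n < N) complex.Re (x n)) +i*
                (N%:R^-1 * \sum_(n < N) complex.Im (x n)).
Proof.
rewrite /average -Re_sum -Im_sum.
have -> : (N%:R^-1 : R[i]) = (N%:R^-1 : R)%:C.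
  by rewrite fmorphV rmorph_nat.
by case: (\sum_(n < N) x n) => u v; simpc.
Qed.

Lemma complex_cvg0P (u : nat -> R[i]) :
  u @ \oo --> (0 : R[i]) <->
  (fun n => complex.Re (u n)) @ \oo --> (0 : R) /\
  (fun n => complex.Im (u n)) @ \oo --> (0 : R).
Proof.
have normE (z : R[i]) : `|z| = (Num.sqrt (complex.Re z ^+ 2 + complex.Im z ^+ 2))%:C.
  exact: normc_def.
have Re_le (z : R[i]) : `|complex.Re z|%:C <= `|z|.
  by rewrite normE lecR -sqrtr_sqr ler_sqrt ?addr_ge0 ?sqr_ge0 // lerDl sqr_ge0.
have Im_le (z : R[i]) : `|complex.Im z|%:C <= `|z|.
  by rewrite normE lecR -sqrtr_sqr ler_sqrt ?addr_ge0 ?sqr_ge0 // lerDr sqr_ge0.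
split=> [/cvgr0Pnorm_lt u0|[/cvgr0Pnorm_lt re0 /cvgr0Pnorm_lt im0]].
  split; apply/cvgr0Pnorm_lt => eps eps_gt0.
    have epsC : 0 < eps%:C by rewrite (ltcR 0).
    by apply: filterS (u0 _ epsC) => n /(le_lt_trans (Re_le _)); rewrite ltcR.
  have epsC : 0 < eps%:C by rewrite (ltcR 0).
  by apply: filterS (u0 _ epsC) => n /(le_lt_trans (Im_le _)); rewrite ltcR.
apply/cvgr0Pnorm_lt => -[eps eps_im]; rewrite ltcE /= => /andP[/eqP -> eps_gt0].
have eps2 : 0 < eps / 2 by rewrite divr_gt0.
apply: filterS2 (re0 _ eps2) (im0 _ eps2) => n re_lt im_lt.
rewrite normE ltcR; apply: (@le_lt_trans _ _ (`|complex.Re (u n)| + `|complex.Im (u n)|)).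
  rewrite -(@ler_pXn2r _ 2) ?nnegrE ?sqrtr_ge0 ?addr_ge0 //.
  rewrite sqr_sqrtr ?addr_ge0 ?sqr_ge0 // sqrrD !real_normK ?num_real //.
  by rewrite -addrA lerD2l lerDr mulrn_wge0 // mulr_ge0.
lra.
Qed.

End ComplexSequences.

Lemma automatic_comp (D D' : Type) (g : D -> D') (a : nat -> D) :
  automatic a -> automatic (g \o a).
Proof.
move=> [k [k_gt1 [A aA]]]; exists k, k_gt1.
exists (Automaton (init A) (trans (a := A)) (g \o out (a := A))) => n.
by rewrite /= aA.
Qed.

Lemma automatic_bounded (R : realType) (a : nat -> R) :
  automatic a -> exists D, forall n, `|a n| <= D.
Proof.
move=> [k [k_gt1 [A aA]]]; exists (\sum_(s : state A) `|out s|) => n.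
rewrite aA; set s := trans_word _ _.
by rewrite (bigD1 s) //= lerDl sumr_ge0.
Qed.

Lemma balanced_Re_Im (R : realType) (a : nat -> R[i]) : totally_balanced a ->
  balanced (fun n => complex.Re (a n)) /\ balanced (fun n => complex.Im (a n)).
Proof.
move=> [_ a_bal]; split=> q r q_gt0.
- have /complex_cvg0P[+ _] := a_bal q r q_gt0.
  by under eq_fun do rewrite averageE /=.
- have /complex_cvg0P[_ +] := a_bal q r q_gt0.
  by under eq_fun do rewrite averageE /=.
Qed.

Theorem theorem2 (R : realType) (a : nat -> R[i])
    (a_automatic : automatic a) (a_balanced : totally_balanced a)
    (d : measure_display) (X : measurableType d) (mu : probability X R)
    (T : X -> X) (T_ergodic : ergodic mu T)
    (f : X -> R[i]) (f_L1 : complex_integrable mu f) :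
  {ae mu, forall x,
    average (fun n => a n * f (iter n T x)) @ \oo --> (0 : R[i])}.
Proof.
have [T_mp _] := T_ergodic.
have [f_re f_im] := f_L1.
have [bal_re bal_im] := balanced_Re_Im a_balanced.
have auto_re := automatic_comp (@complex.Re R) a_automatic.
have auto_im := automatic_comp (@complex.Im R) a_automatic.
have [Dre reD] := automatic_bounded auto_re.
have [Dim imD] := automatic_bounded auto_im.
have rr := integrable_weighted_ergodic T_mp auto_re bal_re reD f_re.
have ri := integrable_weighted_ergodic T_mp auto_re bal_re reD f_im.
have ir := integrable_weighted_ergodic T_mp auto_im bal_im imD f_re.
have ii := integrable_weighted_ergodic T_mp auto_im bal_im imD f_im.
apply: filterS2 (filterI rr ii) (filterI ri ir) => x [rr_x ii_x] [ri_x ir_x].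
apply/complex_cvg0P; split.
- under eq_fun do rewrite averageE /=.
  have := cvgB rr_x ii_x; rewrite subrr => /(_ _); apply: cvg_trans.
  apply: near_eq_cvg; apply: nearW => N /=.
  rewrite fctE /= -mulrBr -sumrB; congr (_ * _); apply: eq_bigr => n _.
  by case: (a n) (f _) => u v [].
- under eq_fun do rewrite averageE /=.
  have := cvgD ri_x ir_x; rewrite addr0 => /(_ _); apply: cvg_trans.
  apply: near_eq_cvg; apply: nearW => N /=.
  rewrite fctE /= -mulrDr -big_split /=; congr (_ * _); apply: eq_bigr => n _.
  by case: (a n) (f _) => u v [].
Qed.
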